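(* Let $c>0$, and let $\varepsilon_0(n)>0$ satisfy $e^{\varepsilon_0(n)}/n\to c^2\in(0,\infty)$. Put $\delta_n:=1/(1+e^{\varepsilon_0(n)})$ and $\lambda:=c^{-2}$. Let $P_n:=\mathrm{Bin}(n,\delta_n)$, let $Q_n$ be the law of the sum of two independent random variables distributed as $\mathrm{Bin}(n-1,\delta_n)$ and $\mathrm{Bern}(1-\delta_n)$, let $P_\infty:=\mathrm{Poi}(\lambda)$, and let $Q_\infty$ be the law of $1+J$ with $J\sim\mathrm{Poi}(\lambda)$. Then for every fixed $\varepsilon\ge0$, $$\delta_{Q_n\|P_n}(\varepsilon)\to\delta_{Q_\infty\|P_\infty}(\varepsilon).$$ Under the canonical calibration $e^{\varepsilon_0(n)}=c^2n$, the convergence is quantitative: $$\bigl|\delta_{Q_n\|P_n}(\varepsilon)-\delta_{Q_\infty\|P_\infty}(\varepsilon)\bigr|\le(1+e^{\varepsilon})\Bigl(\frac{2}{c^2n}+\frac{2}{c^4n}\Bigr).$$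
   Context: For probability measures $P,Q$ on a common measurable space and $\varepsilon\ge0$, the one-sided privacy curve is $\delta_{Q\|P}(\varepsilon):=\sup_A\{Q(A)-e^{\varepsilon}P(A)\}$, the supremum over measurable sets $A$. (It is distinct from the flip probability $\delta_n$.) *)

(* Defs.v *)
From HB Require Import structures.
From mathcomp Require Import all_boot all_order all_algebra.
From mathcomp Require Import all_classical all_reals all_analysis.

Set Implicit Arguments.
Unset Strict Implicit.
Unset Printing Implicit Defensive.

Import Order.TTheory GRing.Theory Num.Theory.
Import numFieldNormedType.Exports.

Local Open Scope classical_set_scope.
Local Open Scope ring_scope.

Definition privacy_gain {R : realType} {d} {T : measurableType d}
    (Q P : probability T R) (eps : R) : set R :=
  [set fine (Q A) - expR eps * fine (P A) | A in measurable].

(* [sup] is total on sets of reals; [has_sup_privacy_gain] shows that no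
   default value is involved here. *)
Definition privacy_curve {R : realType} {d} {T : measurableType d}
    (Q P : probability T R) (eps : R) : R :=
  sup (privacy_gain Q P eps).

Lemma has_sup_privacy_gain {R : realType} {d} {T : measurableType d}
    (Q P : probability T R) (eps : R) : has_sup (privacy_gain Q P eps).
Proof.
split; first by exists (fine (Q set0) - expR eps * fine (P set0)), set0.
exists 1 => _ [A mA <-].
have Q1 : fine (Q A) <= 1.
  by rewrite -lee_fin fineK ?fin_num_measure// probability_le1.
by rewrite lerBlDr ler_wpDr// mulr_ge0 ?expR_ge0// fine_ge0.
Qed.

Section independent_pair.
Context {R : realType} {d1 d2} {T1 : measurableType d1} {T2 : measurableType d2}.
Variables (P1 : probability T1 R) (P2 : probability T2 R).
Local Open Scope ereal_scope.

(* The joint law of two independent random variables with laws P1 and P2. *)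
Definition independent_pair : set (T1 * T2) -> \bar R := P1 \x P2.

HB.instance Definition _ := Measure.on independent_pair.

Let independent_pair_setT : independent_pair setT = 1.
Proof.
rewrite /independent_pair -setXTT product_measure1E//.
rewrite [X in X * _](_ : _ = 1); last exact: (probability_setT P1).
by rewrite [X in _ * X](_ : _ = 1) ?mule1//; exact: (probability_setT P2).
Qed.

HB.instance Definition _ :=
  @Measure_isProbability.Build _ _ R independent_pair independent_pair_setT.

End independent_pair.

(* A Bernoulli variable lives on bool; it is added through the coercion
   true |-> 1, false |-> 0. *)
Definition add_nat_bool (z : nat * bool) : nat := (z.1 + z.2)%N.

Lemma measurable_add_nat_bool : measurable_fun setT add_nat_bool.
Proof.
by apply: measurable_realfun.measurable_fun_addn => //; exact: (measurableT_comp (f := nat_of_bool)).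
Qed.

HB.instance Definition _ :=
  isMeasurableFun.Build _ _ _ _ add_nat_bool measurable_add_nat_bool.

Definition add1_nat (j : nat) : nat := (1 + j)%N.

Lemma measurable_add1_nat : measurable_fun setT add1_nat.
Proof. by []. Qed.

HB.instance Definition _ :=
  isMeasurableFun.Build _ _ _ _ add1_nat measurable_add1_nat.

Section laws.
Context {R : realType}.

Definition flip_prob (eps0 : R) : R := (1 + expR eps0)^-1.

Definition P_law (n : nat) (delta : R) : probability nat R :=
  binomial_prob n delta.

(* The predecessor is truncated: the law is the intended one for 0 < n. *)
Definition Q_law (n : nat) (delta : R) : probability nat R :=
  distribution
    (independent_pair (binomial_prob n.-1 delta) (bernoulli_prob (1 - delta)))
    add_nat_bool.

(* The last argument of [poisson_prob] is a dummy that its body ignores. *)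
Definition P_lim (lambda : R) : probability nat R := poisson_prob lambda 0%N.

Definition Q_lim (lambda : R) : probability nat R :=
  distribution (P_lim lambda) add1_nat.

End laws.

(* Main.v *)
(* The privacy curve is (1, e^eps)-Lipschitz for the uniform distances
   sup_A |Q(A) - Q'(A)| and sup_A |P(A) - P'(A)|, so it suffices to bound these.
   For a test sequence f with values in [0, 1], the Poisson mean m_f(t) has
   derivative m_{Sf}(t) - m_f(t), where S is the shift. Hence m_f is 1-Lipschitz,
   and a second-order Taylor estimate shows that one Bernoulli(p) step
   (1 - p) m_f(t) + p m_{Sf}(t) differs from m_f(t + p) by at most p^2; induction
   on n gives Le Cam's bound |Bin(n, p)(A) - Poi(n p)(A)| <= n p^2.
   Replacing the Bern(1 - delta) summand of Q_n by 1 costs another delta. *)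

Require Import Defs.
From mathcomp Require Import all_boot all_order all_algebra.
From mathcomp Require Import all_classical all_reals all_analysis.
From mathcomp Require Import ring lra.

Import Order.TTheory GRing.Theory Num.Theory.
Import numFieldNormedType.Exports.

Local Open Scope classical_set_scope.
Local Open Scope ring_scope.

(** * Binomial and Poisson expectations of test sequences *)

Section means.
Context {R : realType}.
Implicit Types (f : nat -> R) (n : nat) (p t : R).

Definition binomial_mean f n p : R :=
  \sum_(k < n.+1) binomial_pmf n p k * f k.

(** Keeping the exponential factor apart leaves a power series in [t], open to termwise
    differentiation. *)
Definition poisson_mean f t : R :=
  expR (- t) * limn (pseries (fun k => f k / k`!%:R) t).

Lemma binomial_mean0 f p : binomial_mean f 0 p = f 0%N.
Proof.
by rewrite /binomial_mean big_ord1 /binomial_pmf !expr0 bin0 mulr1 mul1r.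
Qed.

(** Conditioning on one trial: a success shifts the test sequence. On coefficients this is Pascal's
    rule. *)
Lemma binomial_meanS f n p : binomial_mean f n.+1 p =
  (1 - p) * binomial_mean f n p + p * binomial_mean (f \o succn) n p.
Proof.
rewrite /binomial_mean !mulr_sumr big_ord_recl.
rewrite [in RHS]big_ord_recl.
rewrite /binomial_pmf !expr0 !subn0 !bin0 !mul1r.
under eq_bigr => i _ do rewrite lift0 subSS binS mulrnDr mulrDl.
rewrite big_split addrA/=; congr (_ + _); last first.
  by apply: eq_bigr => i _; rewrite exprS -[p * _ * _]mulrA -(mulrnAr p) -mulrA.
rewrite big_ord_recr/= bin_small// mulr0n mul0r addr0 exprS mulrA.
congr (_ + _); apply: eq_bigr => i _.
rewrite /= /bump add1n.
rewrite -(subnSK (ltn_ord i)).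
by rewrite (exprS (unstable.onem p)) mulrCA -(mulrnAr (unstable.onem p)) -mulrA.
Qed.

Lemma is_cvg_pseries_fact f t : (forall k, 0 <= f k <= 1) ->
  cvgn (pseries (fun k => f k / k`!%:R) t).
Proof.
move=> f01; apply: normed_cvg.
apply: (series_le_cvg _ _ _ (is_cvg_series_exp_coeff `|t|)) => /= k.
- exact: normr_ge0.
- by rewrite /exp_coeff/= divr_ge0.
- have /andP[f0 f1] := f01 k.
  rewrite /exp_coeff/= normrM normrX mulrC ler_wpM2l// ger0_norm ?divr_ge0//.
  by rewrite ler_piMl// invr_ge0.
Qed.

Lemma pseries_diffs_fact f :
  pseries_diffs (fun k => f k / k`!%:R) = (fun k => f k.+1 / k`!%:R).
Proof.
apply/funext => k; rewrite /pseries_diffs factS natrM invfM mulrCA.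
by rewrite mulVKf// pnatr_eq0.
Qed.

(** Product rule: differentiating the exponential generating function shifts [f], and the factor
    [expR (- t)] contributes the negative term. *)
Lemma is_derive_poisson_mean f t : (forall k, 0 <= f k <= 1) ->
  is_derive t 1 (poisson_mean f) (poisson_mean (f \o succn) t - poisson_mean f t).
Proof.
move=> f01.
have ds : is_derive t 1 (fun x => limn (pseries (fun k => f k / k`!%:R) x))
    (limn (pseries (fun k => f k.+1 / k`!%:R) t)).
  rewrite -pseries_diffs_fact.
  (* Any radius beyond [|t|] would do: the series and its first two formal derivatives are dominated
     by the exponential series everywhere. *)
  apply: (@pseries_snd_diffs _ _ (`|t| + 1)); rewrite ?pseries_diffs_fact.
  - exact: is_cvg_pseries_fact.
  - exact: (is_cvg_pseries_fact (f \o succn) _ (fun k => f01 k.+1)).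
  - exact: (is_cvg_pseries_fact (f \o succn \o succn) _ (fun k => f01 k.+2)).
  - by rewrite [ltRHS]ger0_norm ?addr_ge0// ltrDl.
rewrite /poisson_mean.
apply: is_derive_eq.
by rewrite /GRing.scale/= /comp; ring.
Qed.

Lemma poisson_mean_itv01 f t : 0 <= t -> (forall k, 0 <= f k <= 1) ->
  0 <= poisson_mean f t <= 1.
Proof.
move=> t0 f01; have cf := is_cvg_pseries_fact f t f01.
apply/andP; split.
  rewrite mulr_ge0 ?expR_ge0//; apply: limr_ge => //; apply: nearW => k.
  apply: sumr_ge0 => i _ /=.
  by have /andP[f0 _] := f01 i; rewrite mulr_ge0 ?divr_ge0 ?exprn_ge0.
rewrite /poisson_mean expRN mulrC ler_pdivrMr ?expR_gt0// mul1r /expR.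
apply: lim_series_le => //; first exact: is_cvg_series_exp_coeff.
move=> k; have /andP[f0 f1] := f01 k.
by rewrite /exp_coeff/= mulrC ler_wpM2l ?exprn_ge0// ler_piMl// invr_ge0.
Qed.

Lemma poisson_mean0 f : poisson_mean f 0 = f 0%N.
Proof.
rewrite /poisson_mean oppr0 expR0 mul1r; apply: lim_near_cst => //.
near=> n; rewrite -[n]prednK; last by near: n.
rewrite /pseries/= /series/= big_nat_recl// big1_seq ?addr0 ?fact0 ?divr1 ?mulr1//.
by move=> i _; rewrite exprS mul0r mulr0.
Unshelve. all: by end_near. Qed.

(** By the mean value theorem, since the derivative is a difference of two numbers in [0, 1]. *)
Lemma poisson_mean_lipschitz f t s : 0 <= t -> 0 <= s ->
  (forall k, 0 <= f k <= 1) -> `|poisson_mean f s - poisson_mean f t| <= `|s - t|.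
Proof.
move=> t0 s0 f01; wlog ts : s t t0 s0 / t <= s.
  move=> h; have [ts|/ltW st] := leP t s; first exact: h.
  by rewrite distrC [leRHS]distrC; exact: h.
have [||x] := @MVT_segment _ (poisson_mean f)
  (fun x => poisson_mean (f \o succn) x - poisson_mean f x) _ _ ts.
- by move=> x _; exact: is_derive_poisson_mean.
- apply: derivable_within_continuous => x _.
  exact: (@ex_derive _ _ _ _ _ _ _ (is_derive_poisson_mean f x f01)).
rewrite in_itv/= => /andP[tx xs] ->; rewrite normrM ler_piMl//.
have x0 := le_trans t0 tx.
have /andP[a0 a1] := poisson_mean_itv01 _ _ x0 f01.
have /andP[b0 b1] := poisson_mean_itv01 _ _ x0 (fun k => f01 k.+1).
by rewrite ler_norml; apply/andP; split; rewrite /comp in b0 b1 *; lra.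
Qed.

(** The derivative bound is integrated by applying the mean value theorem to
    [k * (x - a) ^+ 2 - F x], whose derivative is nonnegative on [a, b]. *)
Lemma ler_derive_linear (F dF : R -> R) (k a b : R) : a <= b ->
  (forall x : R, is_derive x 1 F (dF x)) ->
  (forall x, a <= x <= b -> dF x <= k * 2 * (x - a)) ->
  F b - F a <= k * (b - a) ^+ 2.
Proof.
move=> ab dFE dFle.
pose G := fun x => k * (x - a) ^+ 2 - F x.
have dG (x : R) : is_derive x 1 G (k * 2 * (x - a) - dF x).
  rewrite /G; apply: is_derive_eq; rewrite /GRing.scale/=; ring.
have [|x] := @MVT_segment _ G (fun x => k * 2 * (x - a) - dF x) _ _ ab.
  apply: derivable_within_continuous => x _.
  exact: (@ex_derive _ _ _ _ _ _ _ (dG x)).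
rewrite in_itv/= => axb GE.
have : 0 <= G b - G a by rewrite GE mulr_ge0 ?subr_ge0// dFle.
by rewrite /G subrr expr0n/= mulr0 sub0r; lra.
Qed.

(** The quantity is the remainder of the first-order Taylor expansion of [poisson_mean f] at [t].
    The derivative is 2-Lipschitz, being a difference of two 1-Lipschitz functions. *)
Lemma poisson_mean_step f t p : 0 <= t -> 0 <= p -> (forall k, 0 <= f k <= 1) ->
  `|(1 - p) * poisson_mean f t + p * poisson_mean (f \o succn) t -
    poisson_mean f (t + p)| <= p ^+ 2.
Proof.
move=> t0 p0 f01.
have f01S k : 0 <= (f \o succn) k <= 1 by exact: f01.
set m := poisson_mean f; set mS := poisson_mean (f \o succn).
pose D := mS t - m t.
(* Subtracting the tangent slope [D] makes the derivative vanish at [t]; this function and its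
   opposite give the two sides of the bound. *)
have dF (x : R) : is_derive x 1 (fun y => m y - y * D) (mS x - m x - D).
  have := is_derive_poisson_mean f x f01; rewrite -/m -/mS => ?.
  by apply: is_derive_eq; rewrite /GRing.scale/= mulr0 add0r mulr1.
have dNF (x : R) : is_derive x 1 (fun y => - (m y - y * D)) (- (mS x - m x - D)).
  exact: is_deriveN (dF x).
have lip x : t <= x <= t + p -> `|mS x - m x - D| <= 2 * (x - t).
  move=> /andP[tx _]; have x0 := le_trans t0 tx.
  rewrite (_ : _ - D = (mS x - mS t) - (m x - m t)); last by rewrite /D; ring.
  rewrite (le_trans (ler_normB _ _))// mulr_natl mulr2n.
  have xt : x - t = `|x - t| by rewrite ger0_norm ?subr_ge0.
  by rewrite xt lerD ?poisson_mean_lipschitz.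
have tp : t <= t + p by rewrite lerDl.
have h1 := @ler_derive_linear _ _ 1 _ _ tp dF
  (fun x hx => ltac:(rewrite mul1r; exact: le_trans (ler_norm _) (lip x hx))).
have h2 := @ler_derive_linear _ _ 1 _ _ tp dNF
  (fun x hx => ltac:(rewrite mul1r; apply: le_trans (ler_norm _) _;
    rewrite normrN; exact: lip x hx)).
move: h1 h2; rewrite (_ : t + p - t = p) ?mul1r; last by ring.
rewrite mulrDl /D => h1 h2.
by rewrite ler_norml; apply/andP; split; lra.
Qed.

Lemma binomial_poisson_mean f n p : 0 <= p <= 1 -> (forall k, 0 <= f k <= 1) ->
  `|binomial_mean f n p - poisson_mean f (n%:R * p)| <= n%:R * p ^+ 2.
Proof.
(* The induction keeps [f] general because the step also uses the shifted sequence. *)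
move=> /andP[p0 p1]; elim: n f => [|n IH] f f01.
  by rewrite binomial_mean0 !mul0r poisson_mean0 subrr normr0.
have np : 0 <= n%:R * p by rewrite mulr_ge0.
have f01S k : 0 <= (f \o succn) k <= 1 by exact: f01.
have hs := poisson_mean_step f _ _ np p0 f01.
have := IH _ f01; have := IH _ f01S.
rewrite binomial_meanS -[n.+1]addn1 natrD !(mulrDl n%:R) !mul1r.
move: hs; set a := binomial_mean _ _ _; set b := binomial_mean _ _ _.
set u := poisson_mean _ _; set v := poisson_mean _ _; set w := poisson_mean _ _.
move=> hs ha hb.
(* The inherited errors are averaged with weights [1 - p] and [p], so they stay at [n%:R * p ^+ 2];
   the new step adds [p ^+ 2]. *)
have -> : (1 - p) * b + p * a - w =
  ((1 - p) * (b - u) + p * (a - v)) + ((1 - p) * u + p * v - w) by ring.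
rewrite (le_trans (ler_normD _ _))// lerD//.
rewrite (le_trans (ler_normD _ _))// !normrM (ger0_norm p0) ger0_norm ?subr_ge0//.
rewrite [leRHS](_ : _ = (1 - p) * (n%:R * p ^+ 2) + p * (n%:R * p ^+ 2));
  last by ring.
by rewrite lerD ?ler_wpM2l ?subr_ge0.
Qed.

End means.

(** * From expectations of indicators to laws and privacy curves *)

Section laws.
Context {R : realType}.
Implicit Types (n : nat) (p t eps : R) (A : set nat).

Lemma indic_itv01 A k : 0 <= (\1_A k : R) <= 1.
Proof. by rewrite indicE; case: (k \in A); rewrite ?lexx ler01. Qed.

Lemma P_lawE n p A : 0 <= p <= 1 ->
  P_law n p A = (binomial_mean \1_A n p)%:E.
Proof.
move=> /andP[p0 p1]; rewrite /P_law /= (@binomial_probE _ _ _ p0 p1) /binomial_mean.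
by rewrite -sumEFin; apply: eq_bigr => k _; rewrite diracE.
Qed.

Lemma P_limE t A : 0 < t -> P_lim t A = (poisson_mean \1_A t)%:E.
Proof.
(* Positivity of [t] selects the Poisson branch of [poisson_prob] rather than its default. *)
move=> t0; rewrite /P_lim /= /poisson_prob t0 esum_mkcond -nneseries_esumT; last first.
  by move=> k; case: ifP => // _; rewrite lee_fin poisson_pmf_ge0.
have E k : (if k \in A then (poisson_pmf t k)%:E else 0%E) =
    ((expR (- t))%:E * (\1_A k / k`!%:R * t ^+ k)%:E)%E.
  rewrite indicE -EFinM; case: ifP => _; last by rewrite !mul0r mulr0.
  by rewrite /poisson_pmf t0 mul1r mulrC (mulrC _^-1).
under eq_eseriesr do rewrite E.
rewrite nneseriesZl; last first.
  move=> k _ /=; have /andP[i0 _] := indic_itv01 A k.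
  by rewrite lee_fin mulr_ge0 ?divr_ge0 ?exprn_ge0 ?(ltW t0).
rewrite /poisson_mean EFinM; congr (_ * _)%E.
rewrite -(EFin_lim (is_cvg_pseries_fact _ t (indic_itv01 A))).
apply/congr_lim/funext => m /=.
by rewrite /pseries /series/= sumEFin.
Qed.

(** Splitting on the bit yields two disjoint rectangles, on which the product measure factors. *)
Lemma preimage_add_nat_bool A : add_nat_bool @^-1` A =
  A `*` [set false] `|` (succn @^-1` A) `*` [set true].
Proof.
apply/seteqP; split => -[k []]; rewrite /add_nat_bool /= ?addn0 ?addn1.
- by right.
- by left.
- by move=> [[]//|[]].
- by move=> [[]//|[]].
Qed.

Lemma Q_lawE n p A : 0 <= p <= 1 -> Q_law n p A =
  (p * binomial_mean \1_A n.-1 p +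
   (1 - p) * binomial_mean (\1_A \o succn) n.-1 p)%:E.
Proof.
move=> p01; rewrite /Q_law /= /distribution /pushforward preimage_add_nat_bool.
rewrite measureU//; last 3 first.
- exact: measurableX.
- exact: measurableX.
- by apply/seteqP; split => // -[k b] [[/= _ ->] []].
have p'01 : 0 <= 1 - p <= 1 by move: p01 => /andP[? ?]; apply/andP; split; lra.
rewrite /= /independent_pair !product_measure1E//=.
have b0 b : \d_b [set false] = (~~ b)%:R%:E :> \bar R.
  by rewrite diracE; case: b; [rewrite memNset|rewrite mem_set].
have b1 b : \d_b [set true] = b%:R%:E :> \bar R.
  by rewrite diracE; case: b; [rewrite mem_set|rewrite memNset].
rewrite !bernoulli_probE// !b0 !b1 /= !mule1 !mule0 add0e adde0.
have := P_lawE n.-1 p A p01; rewrite /P_law /= => ->.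
have := P_lawE n.-1 p (succn @^-1` A) p01; rewrite /P_law /= => ->.
rewrite -!EFinM -EFinD /unstable.onem; congr EFin; rewrite (_ : 1 - (1 - p) = p); last by ring.
by rewrite [p * _]mulrC [(1 - p) * _]mulrC.
Qed.

Lemma Q_limE t A : 0 < t -> Q_lim t A = (poisson_mean (\1_A \o succn) t)%:E.
Proof. exact: (P_limE t (succn @^-1` A)). Qed.

(** On each event the two gains differ by at most [a + expR eps * b], and suprema inherit this;
    [half] is one direction, used twice by symmetry. *)
Lemma privacy_curve_dist d (T : measurableType d) (Q P Q' P' : probability T R)
    eps (a b : R) :
  (forall B, measurable B -> `|fine (Q B) - fine (Q' B)| <= a) ->
  (forall B, measurable B -> `|fine (P B) - fine (P' B)| <= b) ->
  `|privacy_curve Q P eps - privacy_curve Q' P' eps| <= a + expR eps * b.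
Proof.
have half (Q1 P1 Q2 P2 : probability T R) :
    (forall B, measurable B -> `|fine (Q1 B) - fine (Q2 B)| <= a) ->
    (forall B, measurable B -> `|fine (P1 B) - fine (P2 B)| <= b) ->
    privacy_curve Q1 P1 eps <= privacy_curve Q2 P2 eps + (a + expR eps * b).
  move=> hQ hP; apply: ge_sup; first by have [] := has_sup_privacy_gain Q1 P1 eps.
  move=> _ [B mB <-]; rewrite -lerBlDr.
  apply: le_trans (ub_le_sup (proj2 (has_sup_privacy_gain Q2 P2 eps)) _); last first.
    by exists B.
  have := hQ _ mB; have := hP _ mB; rewrite !ler_norml => /andP[hP' _] /andP[_ hQ'].
  have := ler_wpM2l (expR_ge0 eps) hP'; rewrite mulrN mulrBr; lra.
move=> hQ hP; rewrite ler_distlC lerBlDr half//=.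
by apply: half => B mB; rewrite distrC; [exact: hQ|exact: hP].
Qed.

(** Triangle inequality through the Poisson law of mean [n%:R * p]: Le Cam's bound, then the
    Lipschitz bound in the mean. *)
Lemma P_law_lim_dist n p t A : 0 <= p <= 1 -> 0 < t ->
  `|fine (P_law n p A) - fine (P_lim t A)| <= n%:R * p ^+ 2 + `|n%:R * p - t|.
Proof.
move=> p01 t0; rewrite P_lawE// P_limE//=.
have i01 := indic_itv01 A; have /andP[p0 _] := p01.
rewrite -(subrK (poisson_mean \1_A (n%:R * p)) (binomial_mean _ _ _)) -addrA.
rewrite (le_trans (ler_normD _ _))// lerD ?binomial_poisson_mean//.
by rewrite poisson_mean_lipschitz ?mulr_ge0 ?(ltW t0).
Qed.

(** One [p] pays for replacing the Bernoulli summand by 1, the other for passing from the mean of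
    [n.-1] trials to that of [n] trials. *)
Lemma Q_law_lim_dist n p t A : (0 < n)%N -> 0 <= p <= 1 -> 0 < t ->
  `|fine (Q_law n p A) - fine (Q_lim t A)| <=
    2 * p + n%:R * p ^+ 2 + `|n%:R * p - t|.
Proof.
case: n => // n _ p01 t0; have /andP[p0 p1] := p01.
have h := P_law_lim_dist n p t (succn @^-1` A) p01 t0.
move: h; rewrite Q_lawE// Q_limE// P_lawE// P_limE//= => h.
have PE (B : set nat) : 0 <= binomial_mean \1_B n p <= 1.
  have := P_lawE n p B p01.
  by move=> PBE; rewrite -!lee_fin -PBE measure_ge0 probability_le1.
have /andP[a0 a1] := PE A; have /andP[b0 b1] := PE (succn @^-1` A).
set a := binomial_mean \1_A _ _ in a0 a1 *.
rewrite -[\1_A \o succn]/(\1_(succn @^-1` A) : nat -> R).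
move: h b0 b1; set b := binomial_mean _ _ _; set u := poisson_mean _ _ => h b0 b1.
rewrite (_ : _ - u = p * (a - b) + (b - u)); last by ring.
rewrite (le_trans (ler_normD _ _))//.
have h1 : `|p * (a - b)| <= p.
  by rewrite normrM ger0_norm// ler_piMr// ler_norml; apply/andP; split; lra.
have h2 : `|n%:R * p - t| <= `|n.+1%:R * p - t| + p.
  rewrite (_ : n%:R * p - t = (n.+1%:R * p - t) - p); last first.
    by rewrite -[n.+1]addn1 natrD; ring.
  by rewrite (le_trans (ler_normB _ _))// (ger0_norm p0).
have h3 : n%:R * p ^+ 2 <= n.+1%:R * p ^+ 2.
  by rewrite ler_wpM2r ?sqr_ge0// ler_nat.
by lra.
Qed.

Lemma privacy_curve_law_lim_dist n p t eps : (0 < n)%N -> 0 <= p <= 1 -> 0 < t ->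
  `|privacy_curve (Q_law n p) (P_law n p) eps -
    privacy_curve (Q_lim t) (P_lim t) eps| <=
  (1 + expR eps) * (2 * p + n%:R * p ^+ 2 + `|n%:R * p - t|).
Proof.
move=> n0 p01 t0; rewrite mulrDl mul1r.
apply: privacy_curve_dist => A _; first exact: Q_law_lim_dist.
apply: le_trans (P_law_lim_dist _ _ _ _ p01 t0) _.
by rewrite lerD2r lerDr; have /andP[p0 _] := p01; rewrite mulr_ge0.
Qed.

End laws.

(** * Convergence of the curves and the explicit rate *)

Theorem corollary3p2 (R : realType) (c : R) (eps0 : nat -> R)
  (c_gt0 : 0 < c)
  (eps0_gt0 : forall n : nat, (0 < n)%N -> 0 < eps0 n)
  (eps0_cvg : expR (eps0 n) / n%:R @[n --> \oo] --> c ^+ 2)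
  (eps : R) (eps_ge0 : 0 <= eps) :
  let delta (n : nat) : R := flip_prob (eps0 n) in
  let lambda : R := c ^- 2 in
  let curve_n (n : nat) : R :=
    privacy_curve (Q_law n (delta n)) (P_law n (delta n)) eps in
  let curve_lim : R := privacy_curve (Q_lim lambda) (P_lim lambda) eps in
  (curve_n n @[n --> \oo] --> curve_lim) /\
  (forall n : nat, (0 < n)%N -> expR (eps0 n) = c ^+ 2 * n%:R ->
    `|curve_n n - curve_lim| <=
      (1 + expR eps) * (2 / (c ^+ 2 * n%:R) + 2 / (c ^+ 4 * n%:R))).
Proof.
move=> delta lambda curve_n curve_lim.
have c2_gt0 : 0 < c ^+ 2 by rewrite exprn_gt0.
have lambda_gt0 : 0 < lambda by rewrite invr_gt0.
have delta_itv n : 0 <= delta n <= 1.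
  have := expR_gt0 (eps0 n) => e0.
  rewrite /delta /flip_prob invr_ge0 invf_le1; last by lra.
  by apply/andP; split; lra.
have bound n : (0 < n)%N -> `|curve_n n - curve_lim| <= (1 + expR eps) *
    (2 * delta n + n%:R * delta n ^+ 2 + `|n%:R * delta n - lambda|).
  by move=> n0; exact: privacy_curve_law_lim_dist.
split.
  have inv_n : n%:R^-1 @[n --> \oo] --> (0 : R).
    by rewrite -cvg_shiftS; exact: cvg_harmonic.
  have n_delta : n%:R * delta n @[n --> \oo] --> lambda.
    (* Dividing numerator and denominator of [n%:R * delta n] by [n] exposes the assumed limit. *)
    have : (n%:R^-1 + expR (eps0 n) / n%:R)^-1 @[n --> \oo] --> (0 + c ^+ 2)^-1.
      by apply: cvgV; [rewrite add0r gt_eqF|exact: cvgD].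
    rewrite add0r; apply: cvg_trans; apply: near_eq_cvg; near=> n.
    have n0 : n%:R != 0 :> R by rewrite pnatr_eq0 -lt0n; near: n; exact: nbhs_infty_gt.
    by rewrite -[X in X + _]mul1r -mulrDl invfM invrK mulrC.
  have delta0 : delta n @[n --> \oo] --> (0 : R).
    have : n%:R^-1 * (n%:R * delta n) @[n --> \oo] --> 0 * lambda by exact: cvgM.
    rewrite mul0r; apply: cvg_trans; apply: near_eq_cvg; near=> n.
    by rewrite mulKf// pnatr_eq0 -lt0n; near: n; exact: nbhs_infty_gt.
  (* The middle term is grouped as a convergent factor times one tending to 0. *)
  have bound_cvg : (1 + expR eps) * (2 * delta n + (n%:R * delta n) * delta n +
      `|n%:R * delta n - lambda|) @[n --> \oo] --> (0 : R).
    rewrite [X in _ --> X](_ : _ = (1 + expR eps) *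
      (2 * 0 + lambda * 0 + `|lambda - lambda|)); last first.
      by rewrite subrr normr0 !mulr0 !addr0 mulr0.
    apply: cvgM; first exact: cvg_cst.
    apply: cvgD; last by apply: cvg_norm; apply: cvgB => //; exact: cvg_cst.
    by apply: cvgD; apply: cvgM => //; exact: cvg_cst.
  apply/subr_cvg0; apply: norm_cvg0.
  apply: (squeeze_cvgr _ (cvg_cst 0) bound_cvg).
  near=> n; rewrite normr_ge0/=.
  have n0 : (0 < n)%N by near: n; exact: nbhs_infty_gt.
  by rewrite -mulrA -expr2; exact: bound.
move=> n n0 en; apply: le_trans (bound n n0) _.
have e0 := expR_gt0 eps.
rewrite ler_pM2l ?addr_gt0//.
have nR : 0 < n%:R :> R by rewrite ltr0n.
have x0 : 0 < c ^+ 2 * n%:R by rewrite mulr_gt0.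
have dE : delta n = (1 + c ^+ 2 * n%:R)^-1 by rewrite /delta /flip_prob en.
have d0 : 0 < delta n by rewrite dE invr_gt0 addr_gt0.
have dle : delta n <= (c ^+ 2 * n%:R)^-1.
  by rewrite dE lef_pV2 ?posrE ?addr_gt0// lerDr.
(* With x = c^2 n one has delta = 1/(1 + x) and n = lambda x, so lambda - n delta = lambda (1 - x/(1
   + x)) = lambda delta. This term and n delta^2 are each at most 1/(c^4 n), hence the second 2 in
   the rate. *)
have nd : `|n%:R * delta n - lambda| = lambda * delta n.
  rewrite ler0_norm; last first.
    rewrite subr_le0 (le_trans (ler_wpM2l (ltW nR) dle))//.
    by rewrite invfM mulrCA mulfV ?mulr1// gt_eqF.
  rewrite dE /lambda; field.
  by rewrite !gt_eqF ?addr_gt0.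
rewrite nd.
have h1 : lambda * delta n <= (c ^+ 4 * n%:R)^-1.
  rewrite (_ : c ^+ 4 * n%:R = c ^+ 2 * (c ^+ 2 * n%:R)); last by ring.
  by rewrite invfM ler_wpM2l ?(ltW lambda_gt0).
have h2 : n%:R * delta n ^+ 2 <= (c ^+ 4 * n%:R)^-1.
  rewrite (_ : (_)^-1 = n%:R * (c ^+ 2 * n%:R)^-1 ^+ 2); last first.
    by field; rewrite !gt_eqF.
  by rewrite ler_wpM2l ?(ltW nR)// lerXn2r ?nnegrE ?(ltW d0)// invr_ge0 ltW.
lra.
Unshelve. all: by end_near. Qed.
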